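(* Let $\alpha\in[0,1]$. Let $G_1$ be a $t_1$-regular graph of order $n_1$ and size $m_1$, and let $G_2$ be an arbitrary graph of order $n_2$. Then $$\begin{aligned}\phi_{A_{\alpha}(G_1 \dot{\vee}_Q G_2)}(\nu) &=(\nu +2 -2\alpha -2\alpha t_1)^{m_1 -n_1}\, \phi_{A_{\alpha}(G_2)}(\nu- \alpha n_1)\\ &\quad\times \prod_{i=2}^{n_1}\Big(\nu^2 -\big(t_1 -2 +\lambda_i(A_{\alpha}(G_1)) +\alpha (2+ t_1 + n_2)\big)\nu - 2\alpha n_2(1-\alpha) -\big(1- \alpha(1+t_1+n_2)\big)\big(t_1 + \lambda_i(A_{\alpha}(G_1))\big) \Big)\\ &\quad\times \Big( (\nu-\alpha t_1 -\alpha n_2)(\nu+2-2\alpha -2t_1) -2t_1(1-\alpha)^2 -n_1(1-\alpha)^2(\nu+2-2\alpha-2t_1)\, \Upsilon_{A_{\alpha}(G_2)}(\nu-\alpha n_1) \Big).\end{aligned}$$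
   Context: All graphs are finite, undirected and simple. For a graph $G$ with adjacency matrix $A(G)$ and diagonal degree matrix $D(G)$, put $A_\alpha(G)=\alpha D(G)+(1-\alpha)A(G)$. For an $n\times n$ matrix $M$, $\phi_M(\nu)=\det(\nu I_n-M)$, and for symmetric $M$ the eigenvalues are listed with multiplicity as $\lambda_1(M)\ge\lambda_2(M)\ge\cdots\ge\lambda_n(M)$. The $M$-coronal is the rational function $\Upsilon_M(\nu)=\mathbf 1_n^T(\nu I_n-M)^{-1}\mathbf 1_n$, where $\mathbf 1_n$ is the all-ones column vector. The identity is an identity of rational functions in $\nu$. The $Q$-graph $\mathcal Q(G)$ is obtained from $G$ by inserting a new vertex into each edge of $G$ (so each edge is subdivided: the new vertex is adjacent to the two ends of the edge, and the original edge is no longer present), and then making two new vertices adjacent whenever they lie on adjacent edges of $G$ (distinct edges sharing an endpoint). The $Q$-vertex join $G_1\dot\vee_Q G_2$ is obtained from the disjoint union of $\mathcal Q(G_1)$ and $G_2$ by joining each original vertex of $G_1$ in $\mathcal Q(G_1)$ to every vertex of $G_2$. *)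

(* Defs.v *)
From HB Require Import structures.
From mathcomp Require Import all_boot all_order all_algebra.
From mathcomp Require Import polyrcf.

Set Implicit Arguments.
Unset Strict Implicit.
Unset Printing Implicit Defensive.

Import Order.TTheory GRing.Theory Num.Theory.
Local Open Scope ring_scope.

Record sgraph := SGraph {
  vertex :> finType;
  adj : rel vertex;
  adj_sym : symmetric adj;
  adj_irr : irreflexive adj }.

Arguments adj {G} : rename.

Definition neighbors (G : sgraph) (x : G) : {set G} := [set y | adj x y].
Definition deg (G : sgraph) (x : G) : nat := #|neighbors x|.
Definition regular (G : sgraph) (t : nat) : Prop := forall x : G, deg x = t.

Definition edges (G : sgraph) : {set {set G}} :=
  [set [set x; y] | x in [set: G], y in neighbors x].

(* The vertices of Q(G) are those of G (inl) and one for each edge of G (inr). *)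
Section QGraph.
Variable G : sgraph.

Definition Qvertex : finType := (G + {e : {set G} | e \in edges G})%type.

Definition Qadj (u v : Qvertex) : bool :=
  match u, v with
  | inl _, inl _ => false
  | inl x, inr e => x \in val e
  | inr e, inl x => x \in val e
  | inr e, inr f => (e != f) && (val e :&: val f != set0)
  end.

Lemma Qadj_sym : symmetric Qadj.
Proof. by case=> [x|e] [y|f] //=; rewrite eq_sym setIC. Qed.

Lemma Qadj_irr : irreflexive Qadj.
Proof. by case=> [x|e] //=; rewrite eqxx. Qed.

Definition Qgraph : sgraph := SGraph Qadj_sym Qadj_irr.

End QGraph.

Section QVertexJoin.
Variables G1 G2 : sgraph.

Definition Qvjoin_adj (u v : Qgraph G1 + G2) : bool :=
  match u, v with
  | inl a, inl b => adj a b
  | inr x, inr y => adj x y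
  | inl (inl _), inr _ => true
  | inr _, inl (inl _) => true
  | inl (inr _), inr _ => false
  | inr _, inl (inr _) => false
  end.

Lemma Qvjoin_adj_sym : symmetric Qvjoin_adj.
Proof. by case=> [[x|e]|x] [[y|f]|y]; rewrite /Qvjoin_adj //; apply: adj_sym. Qed.

Lemma Qvjoin_adj_irr : irreflexive Qvjoin_adj.
Proof. by case=> [u|x]; rewrite /Qvjoin_adj; [case: u => *|]; apply: adj_irr. Qed.

Definition Qvertex_join : sgraph := SGraph Qvjoin_adj_sym Qvjoin_adj_irr.

End QVertexJoin.

Section GraphMatrices.
Variables (R : rcfType) (G : sgraph).

Definition adjacency_mx : 'M[R]_#|G| :=
  \matrix_(i, j) (adj (enum_val i) (enum_val j))%:R.

Definition degree_mx : 'M[R]_#|G| :=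
  diag_mx (\row_i (deg (enum_val i))%:R).

Definition A_alpha (alpha : R) : 'M[R]_#|G| :=
  alpha *: degree_mx + (1 - alpha) *: adjacency_mx.

End GraphMatrices.

(* Roots in R of the characteristic polynomial, repeated according to their
   multiplicity; when M is symmetric this list has length n. *)
Definition eigenvalues (R : rcfType) (n : nat) (M : 'M[R]_n) : seq R :=
  sort >=%R (flatten [seq nseq (mup x (char_poly M)) x
                     | x <- rootsR (char_poly M)]).

(* Numbered from 1: eigval M 1 is the largest eigenvalue. *)
Definition eigval (R : rcfType) (n : nat) (M : 'M[R]_n) (i : nat) : R :=
  nth 0 (eigenvalues M) i.-1.

Definition ratfun (R : rcfType) : fieldType := {fraction {poly R}}.

Definition ratvar (R : rcfType) : ratfun R := tofrac 'X.

Definition ratconst (R : rcfType) (c : R) : ratfun R := tofrac c%:P.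

(* phi M z and coronal M z take the rational function z as argument: at
   z = ratvar R they are phi_M(nu) and Upsilon_M(nu), and at
   z = ratvar R - c they are phi_M(nu - c) and Upsilon_M(nu - c). *)
Definition phi (R : rcfType) (n : nat) (M : 'M[R]_n) (z : ratfun R) : ratfun R :=
  \det (z%:M - map_mx (@ratconst R) M).

Definition coronal (R : rcfType) (n : nat) (M : 'M[R]_n) (z : ratfun R) :
    ratfun R :=
  let one : 'cV[ratfun R]_n := const_mx 1 in
  (one^T *m invmx (z%:M - map_mx (@ratconst R) M) *m one) 0 0.

(* Main.v *)
(* Let [b = 1 - alpha], let [Rm] be the vertex-edge incidence matrix of [G1] and
   [J] the all-ones matrix.  Regularity of [G1] gives
   [Rm *m Rm^T = A(G1) + t1 I], and the edge-edge block of [Q(G1)] is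
   [Rm^T *m Rm - 2 I].  A Schur complement on the [G2] block replaces it by
   the coronal times [J]; subtracting a multiple of the vertex rows from the
   edge rows makes the edge block scalar, and what remains is the determinant of
   [p I - q A_alpha(G1) - s J].  As [A_alpha(G1)] has constant row sums [t1],
   this rank-one perturbation only changes the factor of the eigenvalue [t1],
   which is the largest one. *)
Require Import Defs.
From HB Require Import structures.
From mathcomp Require Import all_boot all_order all_algebra.
From mathcomp Require Import perm polyrcf complex ring.
Set Implicit Arguments.
Unset Strict Implicit.
Unset Printing Implicit Defensive.

Import Order.TTheory GRing.Theory Num.Theory.
Local Open Scope ring_scope.

(** * Spectra of symmetric matrices *)

(** Over [complex R] the matrix becomes Hermitian, hence diagonalisable with real spectrum. The
    factorisation found there descends to [R] because the embedding of polynomials is injective. *)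
Lemma char_poly_symmetric_split (R : rcfType) (n : nat) (A : 'M[R]_n) :
  A^T = A -> exists s : seq R, char_poly A = \prod_(x <- s) ('X - x%:P).
Proof.
move=> Asym; pose C : numClosedFieldType := complex R.
pose f : {rmorphism R -> C} := real_complex R.
pose B := map_mx f A.
have Bh : B \is hermsymmx.
  apply: realsym_hermsym.
    apply/is_hermitianmxP; rewrite expr0 scale1r map_mx_id // /B.
    by rewrite map_trmx Asym.
  by apply/mxOverP=> i j; rewrite mxE; apply/complex_realP; exists (A i j).
have [P [Pu PB]] : exists P,
    P \in unitmx /\ B = invmx P *m diag_mx (spectral_diag B) *m P.
  exists (spectralmx B); split; first exact: spectral_unit.
  exact/orthomx_spectralP/hermitian_normalmx.
have dr i : (complex.Re (spectral_diag B 0 i))%:C%C = spectral_diag B 0 i.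
  apply: RRe_real; exact: (mxOverP (hermitian_spectral_diag_real Bh)).
exists [seq complex.Re (spectral_diag B 0 i) | i <- enum 'I_n].
apply: (map_poly_inj f).
rewrite map_char_poly -/B.
(* The characteristic polynomial is invariant under conjugation by [P]. *)
have -> : char_poly B = char_poly (diag_mx (spectral_diag B)).
  rewrite {1}PB /char_poly.
  pose Q := map_mx (@polyC C) P.
  have QV : map_mx polyC (invmx P) *m Q = 1%:M
    by rewrite -map_mxM mulVmx // map_mx1.
  have -> : char_poly_mx (invmx P *m diag_mx (spectral_diag B) *m P) =
     map_mx polyC (invmx P) *m char_poly_mx (diag_mx (spectral_diag B)) *m Q.
    rewrite /char_poly_mx mulmxBr mulmxBl !map_mxM; congr (_ - _).
    by rewrite mul_mx_scalar -scalemxAl QV scalemx1.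
  rewrite !det_mulmx mulrC mulrA -det_mulmx.
  by rewrite (mulmx1C QV) det1 mul1r.
rewrite char_poly_trig ?diag_mx_is_trig // rmorph_prod /= big_map big_enum /=.
apply: eq_bigr => i _; rewrite mxE eqxx mulr1n rmorphB /= map_polyX map_polyC /=.
by rewrite dr.
Qed.

(** In both lists each [x] occurs as often as its multiplicity as a root, so any known splitting
    describes the eigenvalue list up to order. *)
Lemma perm_eigenvalues (R : rcfType) (n : nat) (A : 'M[R]_n) (s : seq R) :
  char_poly A = \prod_(x <- s) ('X - x%:P) -> perm_eq (eigenvalues A) s.
Proof.
move=> As; rewrite /eigenvalues perm_sort; apply/allP => x _ /=; apply/eqP.
have p0 : char_poly A != 0 by rewrite monic_neq0 ?char_poly_monic.
rewrite count_flatten -map_comp /=.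
rewrite -mu_prod_XsubC -As.
(* A non-root has multiplicity zero, so the membership factor changes nothing. With it the count
   holds for every duplicate-free list, which permits induction. *)
have -> : mup x (char_poly A) =
    ((x \in rootsR (char_poly A)) * mup x (char_poly A))%N.
  rewrite -roots_on_rootsR // andTb.
  by case: (boolP (root _ x)) => [|/mupNroot ->]; rewrite ?mul1n ?muln0.
have : uniq (rootsR (char_poly A)) by exact: uniq_roots.
elim: (rootsR _) => //= y r IHr /andP[yr ur].
rewrite IHr // count_nseq /= in_cons [y == x]eq_sym; case: eqP => [->|_] //=.
by rewrite (negPf yr) addn0.
Qed.

(** At a coordinate [j] where [|v_j|] is maximal, [v *m A = a *: v] gives
    [a |v_j| <= sum_i |v_i| A_ij <= t |v_j|]. *)
Lemma eigenvalue_le_col_sum (R : realFieldType) (n : nat) (A : 'M[R]_n) (t a : R) :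
  (forall i j, 0 <= A i j) -> (forall j, \sum_i A i j = t) ->
  eigenvalue A a -> a <= t.
Proof.
move=> A0 At /eigenvalueP [v vA v0].
have [j0 vj0] : exists j, v 0 j != 0.
  apply/existsP; apply: contra_neqT v0 => /existsPn v0.
  by apply/rowP=> j; rewrite mxE; apply/eqP; rewrite -[_ == _]negbK v0.
pose j := [arg max_(i > j0) `|v 0 i|]%O.
have vj i : `|v 0 i| <= `|v 0 j| by rewrite /j; case: arg_maxP => // k _; apply.
have vj_gt0 : 0 < `|v 0 j| by rewrite (lt_le_trans _ (vj j0)) ?normr_gt0.
rewrite -(ler_pM2r vj_gt0) (le_trans (ler_wpM2r _ (ler_norm a))) ?normr_ge0 //.
move/rowP: vA => /(_ j); rewrite !mxE => vA.
rewrite -normrM -vA (le_trans (ler_norm_sum _ _ _)) // -(At j) mulr_suml.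
by apply: ler_sum => i _; rewrite normrM mulrC (ger0_norm (A0 _ _)) ler_wpM2l.
Qed.

(* A nonnegative symmetric matrix with constant row sum [t] has [t] as its
   largest eigenvalue, so numbering from 2 leaves out exactly one copy of [t]. *)
Lemma char_poly_const_col_sum (R : rcfType) (n : nat) (A : 'M[R]_n) (t : R) :
  (0 < n)%N -> A^T = A -> (forall i j, 0 <= A i j) ->
  (forall j, \sum_i A i j = t) ->
  char_poly A = ('X - t%:P) * \prod_(2 <= i < n.+1) ('X - (eigval A i)%:P).
Proof.
move=> n0 Asym A0 At.
have [s As] := char_poly_symmetric_split Asym.
have es := perm_eigenvalues As.
have {es}Ae : char_poly A = \prod_(x <- eigenvalues A) ('X - x%:P).
  by rewrite As; apply/esym/perm_big.
have sz : size (eigenvalues A) = n.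
  by have := size_char_poly A; rewrite Ae size_prod_XsubC => -[].
have ev x : (x \in eigenvalues A) = eigenvalue A x.
  by rewrite eigenvalue_root_char Ae root_prod_XsubC.
have te : eigenvalue A t.
  (* Eigenvectors are row vectors here, so constant column sums make the all-ones row an
     eigenvector. *)
  apply/eigenvalueP; exists (const_mx 1).
    apply/rowP=> j; rewrite !mxE mulr1 -(At j).
    by apply: eq_bigr => i _; rewrite mxE mul1r.
  apply/eqP => /rowP/(_ (Ordinal n0))/eqP; by rewrite !mxE oner_eq0.
have srt : sorted >=%R (eigenvalues A).
  by apply: sort_sorted; move=> x y; apply: le_total.
have h : eigval A 1 = t.
  rewrite /eigval /=; apply/le_anti/andP; split.
    apply: (@eigenvalue_le_col_sum _ _ A) => //; rewrite -ev mem_nth //.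
    by rewrite sz.
  (* Conversely [t] lies in the decreasing list, so the head is at least [t]. *)
  move: te; rewrite -ev; case: (eigenvalues A) srt => //= x r pr.
  rewrite inE => /orP[/eqP->//|tr].
  have := order_path_min _ pr => /(_ _)/allP; apply => //.
  by move=> y1 y2 y3 /= h1 h2; apply: le_trans h2 h1.
(* [nth] counts from 0 and [eigval] from 1: the positions after the head are the indices [2] to
   [n]. *)
rewrite {1}Ae (big_nth 0) sz big_ltn // -/(eigval A 1) h; congr (_ * _).
by rewrite [RHS]big_add1.
Qed.

(** * Determinants of block matrices *)

(** Right multiplication by a unit lower triangular block matrix clears [Z] and preserves the
    determinant. *)
Lemma det_schur (K : fieldType) (n k : nat) (X : 'M[K]_n) (Y : 'M_(n, k))
    (Z : 'M_(k, n)) (W : 'M_k) : W \in unitmx ->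
  \det (block_mx X Y Z W) = \det W * \det (X - Y *m invmx W *m Z).
Proof.
move=> Wu; have := congr1 determinant
  (mulmx_block X Y Z W 1%:M 0 (- (invmx W *m Z)) 1%:M).
rewrite det_mulmx det_lblock !det1 !mulr1 => ->.
rewrite !mulmx1 !mulmx0 !add0r !mulmxN mulKVmx // subrr det_ublock.
by rewrite mulmxA mulrC.
Qed.

(* Subtracting [V] times the first block row from the second one turns the
   lower-right block into a scalar, which is then eliminated. *)
Lemma det_block_scalar_perturb (K : fieldType) (n m : nat) (P S : 'M[K]_n)
    (U : 'M_(n, m)) (V : 'M_(m, n)) (c : K) : c != 0 ->
  \det (block_mx P U (V *m S) (c%:M + V *m U)) =
  c ^ (m%:Z - n%:Z) * \det (c *: P - U *m V *m (S - P)).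
Proof.
move=> c0; set D := \det (block_mx _ _ _ _); set E := \det (_ - _).
(* The integer [m - n] may be negative, so the identity is first proved with natural exponents. *)
have DE : D * c ^+ n = E * c ^+ m.
  have e1 : block_mx 1%:M 0 (- V) 1%:M *m
    block_mx P U (V *m S) (c%:M + V *m U) = block_mx P U (V *m (S - P)) c%:M.
    rewrite mulmx_block !mul1mx !mul0mx !addr0 !mulNmx mulmxBr.
    by congr block_mx; rewrite addrC ?addrK.
  have e2 : block_mx P U (V *m (S - P)) c%:M *m
    block_mx c%:M 0 (- (V *m (S - P))) 1%:M =
    block_mx (c *: P - U *m V *m (S - P)) U 0 c%:M.
    rewrite mulmx_block !mulmx1 !mulmx0 !add0r !mul_mx_scalar mul_scalar_mx.
    by rewrite scalerN subrr mulmxN mulmxA.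
  move/(congr1 determinant): e2; move/(congr1 determinant): e1.
  rewrite !det_mulmx !det_lblock !det_ublock !det1 !mul1r mulr1 !det_scalar.
  by rewrite -/D -/E => ->.
rewrite expfzDr // -invr_expz -!exprnP mulrAC [_ * E]mulrC -DE.
by rewrite mulfK // expf_neq0.
Qed.

(** A constant matrix factors through the all-ones column, so [W] enters only through its quadratic
    form there. For [W] a resolvent this form is the coronal. *)
Lemma const_mx_mul_const (K : fieldType) (n k l : nat) (W : 'M[K]_k) (u v : K) :
  (const_mx u : 'M_(n, k)) *m W *m (const_mx v : 'M_(k, l)) =
  const_mx (u * v *
    (((const_mx 1 : 'cV[K]_k)^T *m W *m (const_mx 1 : 'cV_k)) 0 0)).
Proof.
have -> : (const_mx u : 'M_(n, k)) = u *: (const_mx 1 *m (const_mx 1 : 'cV_k)^T).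
  by apply/matrixP=> i j; rewrite !mxE big_ord1 !mxE !mulr1.
have -> : (const_mx v : 'M_(k, l)) = v *: ((const_mx 1 : 'cV_k) *m const_mx 1).
  by apply/matrixP=> i j; rewrite !mxE big_ord1 !mxE !mulr1.
rewrite -!scalemxAl -scalemxAr scalerA !mulmxA.
set X : 'M_1 := _^T *m W *m const_mx 1.
rewrite -(mulmxA (const_mx 1)) -(mulmxA (const_mx 1)) -/X [X]mx11_scalar mul_mx_scalar.
by apply/matrixP=> i j; rewrite !mxE big_ord1 !mxE !mulr1.
Qed.

(** The matrix [M] bordered by [u] and [v] is triangularised in two ways, which compares both
    determinants without inverting [M]. *)
Lemma det_sub_rank1 (K : fieldType) (n : nat) (M : 'M[K]_n) (r s : K) :
  r != 0 -> M *m (const_mx 1 : 'cV_n) = const_mx r ->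
  \det (M - const_mx s) * r = \det M * (r - s * n%:R).
Proof.
move=> r0 M1; pose u : 'cV[K]_n := const_mx 1.
pose v := const_mx s : 'rV[K]_n.
have e1 : block_mx M u v 1%:M *m block_mx 1%:M 0 (- v) 1%:M =
  block_mx (M - const_mx s) u 0 1%:M :> 'M_(n + 1).
  rewrite mulmx_block !mulmx1 !mulmx0 !mul1mx !add0r subrr mulmxN.
  congr (block_mx (_ - _)  _ _ _); apply/matrixP=> i j.
  by rewrite !mxE big_ord1 !mxE mul1r.
(* Since [M *m u = r *: u], this column operation clears the border [u]. *)
have e2 : block_mx M u v 1%:M *m block_mx 1%:M (- u) 0 r%:M =
  block_mx M 0 v (r - s * n%:R)%:M :> 'M_(n + 1).
  rewrite mulmx_block !mulmx1 !mulmx0 !addr0 !mul_mx_scalar !mulmxN M1.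
  congr block_mx; apply/matrixP=> i j; rewrite !mxE ?mulr1 ?addNr //.
  rewrite !ord1 (eq_bigr (fun=> s)) => [|k _]; last by rewrite !mxE mulr1.
  by rewrite sumr_const card_ord eqxx !mulr1 mulr1n mulr_natr addrC.
move/(congr1 determinant): e1; move/(congr1 determinant): e2.
rewrite !det_mulmx !det_lblock !det_ublock !det1 !mulr1 !mul1r !det_scalar1.
by move=> h <-.
Qed.

(** * Determinants of matrix pencils and the incidence block matrix *)

Lemma horner_char_poly (K : fieldType) (n : nat) (A : 'M[K]_n) (z : K) :
  (char_poly A).[z] = \det (z%:M - A).
Proof.
rewrite -horner_evalE -det_map_mx; congr (\det _); apply/matrixP => i j.
by rewrite !mxE /= /horner_eval hornerD hornerN hornerMn hornerX hornerC.
Qed.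

Lemma det_pencil (K : fieldType) (n : nat) (A : 'M[K]_n) (p q : K) :
  q != 0 -> \det (p%:M - q *: A) = q ^+ n * (char_poly A).[p / q].
Proof.
move=> q0; rewrite horner_char_poly -detZ scalerBr scale_scalar_mx.
by rewrite mulrCA divff // mulr1.
Qed.

Lemma det_pencil_split (K : fieldType) (n : nat) (B : 'M[K]_n) (p q t : K)
    (l : nat -> K) : (0 < n)%N -> q != 0 ->
  char_poly B = ('X - t%:P) * \prod_(2 <= i < n.+1) ('X - (l i)%:P) ->
  \det (p%:M - q *: B) = (p - q * t) * \prod_(2 <= i < n.+1) (p - q * l i).
Proof.
move=> n0 q0 Bs; rewrite det_pencil // Bs hornerM horner_prod !hornerE.
have e y : p - q * y = q * (p / q - y) by rewrite mulrBr mulrCA divff // mulr1.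
rewrite e (eq_bigr _ (fun i _ => e (l i))) big_split /= prodr_const_nat.
(* One power of [q] goes to the root [t], the other [n - 1] to the remaining roots. *)
rewrite subSS subn1 -[in X in X * _](prednK n0) exprS mulrACA.
rewrite -mulrA; congr (_ * (_ * _)); apply: eq_bigr => i _.
by rewrite hornerXsubC.
Qed.

(** The linear algebra of the theorem, free of graphs: [B] stands for [A_alpha] of [G1], [b] for
    [1 - alpha], [x] and [c] for the scalar parts of the vertex and edge blocks, [W] for the [G2]
    block. *)
Lemma det_incidence_join (K : fieldType) (n m k : nat) (B : 'M[K]_n)
    (Rm : 'M_(n, m)) (W : 'M_k) (l : nat -> K) (b c x r t : K) :
  let ups := ((const_mx 1 : 'cV_k)^T *m invmx W *m (const_mx 1 : 'cV_k)) 0 0 in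
  let p := c * x - r * (b + x) in
  let q := b + x in
  (0 < n)%N -> W \in unitmx -> c != 0 -> q != 0 -> p - q * t != 0 ->
  b *: (Rm *m Rm^T) = B + r%:M ->
  B *m (const_mx 1 : 'cV_n) = const_mx t ->
  char_poly B = ('X - t%:P) * \prod_(2 <= i < n.+1) ('X - (l i)%:P) ->
  \det (block_mx
    (block_mx x%:M (- (b *: Rm)) (- (b *: Rm^T)) (c%:M - b *: (Rm^T *m Rm)))
    (col_mx (const_mx (- b)) 0) (row_mx (const_mx (- b)) 0) W) =
  c ^ (m%:Z - n%:Z) * \det W * (\prod_(2 <= i < n.+1) (p - q * l i)) *
  (p - q * t - b ^+ 2 * ups * (c - t - r) * n%:R).
Proof.
move=> ups p q n0 Wu c0 q0 pqt RR B1 Bs.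

rewrite det_schur //.
have -> : block_mx x%:M (- (b *: Rm)) (- (b *: Rm^T)) (c%:M - b *: (Rm^T *m Rm))
    - col_mx (const_mx (- b)) 0 *m invmx W *m row_mx (const_mx (- b)) 0 =
  block_mx (x%:M - const_mx (b ^+ 2 * ups)) (- (b *: Rm)) (Rm^T *m (- b)%:M)
    (c%:M + Rm^T *m (- (b *: Rm))).
  rewrite mul_col_mx mul_col_row !mul0mx mulmx0 opp_block_mx add_block_mx.
  rewrite const_mx_mul_const mulrNN -expr2 -/ups !oppr0 !addr0 mul_mx_scalar.
  by rewrite scaleNr mulmxN -scalemxAr.
have BJ u : B *m (const_mx u : 'M_n) = const_mx (t * u).
  apply/matrixP=> i j; rewrite !mxE; move/matrixP/(_ i 0): B1; rewrite !mxE => <-.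
  by rewrite mulr_suml; apply: eq_bigr => y _; rewrite !mxE mulr1.
set s := b ^+ 2 * ups.
rewrite det_block_scalar_perturb // mulNmx -scalemxAl RR.
(* Replacing [b *: (Rm *m Rm^T)] by [B + r%:M] leaves a polynomial in [B] and the all-ones matrix
   [J]; [B *m J = t *: J] then collects every [J] term into one. *)
rewrite [c *: _ - _](_ : _ = (p%:M - q *: B) - const_mx (s * (c - t - r))).
  have := @det_sub_rank1 _ _ (p%:M - q *: B) (p - q * t) (s * (c - t - r)) pqt.
  rewrite mulmxBl mul_scalar_mx -scalemxAl B1 => /(_ _)/(canRL (mulfK pqt)) ->.
    by rewrite (det_pencil_split _ n0 q0 Bs); field.
  by apply/matrixP=> i j; rewrite !mxE mulr1.
rewrite mulNmx opprK mulmxDl mul_scalar_mx !mulmxBr BJ !mul_mx_scalar.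
by apply/matrixP=> i j; rewrite !mxE /p /q; case: (i == j);
  rewrite ?mulr1n ?mulr0n; ring.
Qed.

(** * Incidence counts and degrees *)

Lemma edgesP (G : sgraph) (e : {set G}) :
  reflect (exists x y, adj x y /\ e = [set x; y]) (e \in edges G).
Proof.
apply: (iffP imset2P) => [[x y _ /[!inE] xy ->]|[x [y [xy ->]]]].
  by exists x, y.
by exists x y; rewrite ?inE.
Qed.

Lemma adj_neq (G : sgraph) (x y : G) : adj x y -> x != y.
Proof. by apply: contraTneq => ->; rewrite adj_irr. Qed.

Lemma card_edge (G : sgraph) (e : {set G}) : e \in edges G -> #|e| = 2.
Proof. by case/edgesP=> x [y [/adj_neq xy ->]]; rewrite cards2 xy. Qed.

(** Distinct edges share at most one vertex. This is what makes the Gram matrix of the incidence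
    columns twice the identity plus the adjacency of edges. *)
Lemma card_edgeI (G : sgraph) (e f : {set G}) :
  e \in edges G -> f \in edges G ->
  #|e :&: f| = ((e == f).*2 + ((e != f) && (e :&: f != set0)))%N.
Proof.
move=> /card_edge e2 /card_edge f2; have [<-|ef] := eqVneq e f.
  by rewrite setIid e2.
rewrite /= -card_gt0; have : (#|e :&: f| < 2)%N.
  rewrite ltnNge; apply: contra ef => h; rewrite eqEcard e2 f2 andbT.
  have /eqP <- : e :&: f == e by rewrite eqEcard subsetIl e2.
  exact: subsetIr.
by case: #|_| => [|[|]].
Qed.

Lemma edge_pair (G : sgraph) (e : {set G}) (x y : G) :
  e \in edges G -> x != y -> x \in e -> y \in e -> e = [set x; y].
Proof.
move=> /card_edge e2 xy xe ye; apply/esym/eqP.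
by rewrite eqEcard subUset !sub1set xe ye e2 cards2 xy.
Qed.

(** The map sending [y] to [[set x; y]] is a bijection from the neighbours of [x] to the edges at
    [x]. *)
Lemma card_edges_through (G : sgraph) (x : G) :
  #|[set e in edges G | x \in e]| = deg x.
Proof.
rewrite /deg -(@card_in_imset _ _ (fun y => [set x; y])); last first.
  move=> y z; rewrite !inE => xy xz /setP/(_ y); rewrite !inE eqxx orbT.
  by rewrite eq_sym (negPf (adj_neq xy)) => /esym/eqP.
apply: eq_card => e; apply/idP/imsetP; rewrite !inE.
  case/andP=> /edgesP[y [z [yz ->]]]; rewrite !inE => /orP[]/eqP ->.
    by exists z; rewrite ?inE.
  by exists y; rewrite 1?setUC // inE adj_sym.
case=> y; rewrite inE => xy ->; rewrite !inE eqxx andbT.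
by apply/edgesP; exists x, y.
Qed.

Lemma card_edges_through2 (G : sgraph) (x y : G) : x != y ->
  #|[set e in edges G | (x \in e) && (y \in e)]| = adj x y.
Proof.
move=> xy; case: (boolP (adj x y)) => a.
  rewrite /= -(cards1 [set x; y]); apply: eq_card => e; rewrite !inE.
  apply/idP/eqP => [/and3P[eG xe ye]|->]; first exact: edge_pair.
  by rewrite !inE !eqxx orbT !andbT; apply/edgesP; exists x, y.
apply/eqP; rewrite cards_eq0; apply/eqP/setP=> e; rewrite !inE.
apply: contraNF a => /and3P[/edgesP[z [w [zw ->]]]]; rewrite !inE => xzw yzw.
move: xzw yzw xy => /orP[]/eqP -> /orP[]/eqP ->; rewrite ?eqxx // => _.
by rewrite adj_sym.
Qed.

Lemma deg_sum (G : sgraph) (x : G) : deg x = (\sum_y adj x y)%N.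
Proof.
by rewrite /deg -sum1_card big_mkcond; apply: eq_bigr => y _; rewrite inE; case: adj.
Qed.

(** Double counting: each of the two ends of [e] lies on [t] edges, [e] itself included. *)
Lemma sum_card_edgeI (G : sgraph) (t : nat) (e : {set G}) :
  regular G t -> e \in edges G -> (\sum_(f in edges G) #|e :&: f| = 2 * t)%N.
Proof.
move=> Gt eG.
under eq_bigr do rewrite -sum1_card big_mkcond.
rewrite exchange_big /=.
transitivity (\sum_(x in e) t)%N; last by rewrite sum_nat_const card_edge.
rewrite [RHS]big_mkcond; apply: eq_bigr => x _.
under eq_bigr do rewrite inE; case: (x \in e) => /=; last by rewrite big1.
rewrite -(Gt x) -card_edges_through -sum1_card -big_mkcondr.
by apply: eq_bigl => f; rewrite inE.
Qed.

Lemma big_edges (G : sgraph) (F : {set G} -> nat) :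
  (\sum_(e : {e : {set G} | e \in edges G}) F (val e) = \sum_(e in edges G) F e)%N.
Proof. by rewrite [RHS]big_sub. Qed.

Lemma sum_incident2 (G : sgraph) (x y : G) :
  (\sum_(e in edges G) ((x \in e) && (y \in e)) =
   if x == y then deg x else adj x y)%N.
Proof.
rewrite (eq_bigr (fun e : {set G} => if (x \in e) && (y \in e) then 1 else 0)%N);
  last by move=> e _; case: (_ && _).
rewrite -big_mkcondr sum1_card; case: eqVneq => [<-|xy].
  by rewrite -card_edges_through; apply: eq_card => e; rewrite unfold_in [RHS]inE andbb.
by rewrite -card_edges_through2 //; apply: eq_card => e; rewrite unfold_in [RHS]inE.
Qed.

Section JoinDegrees.
Variables (G1 G2 : sgraph).
Implicit Types (x : G1) (e : {e : {set G1} | e \in edges G1}) (z : G2).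

Lemma deg_join_vertex x :
  @deg (Qvertex_join G1 G2) (inl (inl x)) = (deg x + #|G2|)%N.
Proof.
rewrite deg_sum !big_sumType /= big1 // add0n sum1_card; congr (_ + _)%N.
rewrite (big_edges (fun f : {set G1} => x \in f)) -card_edges_through -sum1_card.
rewrite (eq_bigr (fun f : {set G1} => if x \in f then 1 else 0)%N);
  last by move=> f _; case: (x \in f).
by rewrite -big_mkcondr; apply: eq_bigl => f; rewrite inE.
Qed.

Lemma deg_join_edge t e : regular G1 t ->
  @deg (Qvertex_join G1 G2) (inl (inr e)) = (2 * t)%N.
Proof.
move=> Gt; rewrite deg_sum !big_sumType /= [X in (_ + X)%N]big1 // addn0.
rewrite -(sum_card_edgeI Gt (valP e)) -big_edges.
under [RHS]eq_bigr => f _ do rewrite (card_edgeI (valP e) (valP f)).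
rewrite big_split /=.
congr (_ + _)%N.
(* The term [f = e] contributes 2, which matches the two ends of [e] as neighbours in the
   $Q$-graph. *)
rewrite [RHS](bigD1 e) //= eqxx [X in (_ + X)%N]big1 ?addn0 => [|f fe]; last first.
  by apply/eqP; rewrite double_eq0 eqb0 eq_sym.
transitivity #|val e|; last by rewrite (card_edge (valP e)).
rewrite -sum1_card [RHS]big_mkcond.
by apply: eq_bigr => x _; case: (x \in _).
Qed.

Lemma deg_join_right z :
  @deg (Qvertex_join G1 G2) (inr z) = (deg z + #|G1|)%N.
Proof.
by rewrite deg_sum !big_sumType /= sum1_card [X in (_ + X + _)%N]big1 // addn0 addnC -deg_sum.
Qed.

End JoinDegrees.

(** * The matrix of the join *)

HB.instance Definition _ (R : rcfType) :=
  GRing.RMorphism.copy (@ratconst R) (@tofrac {poly R} \o polyC).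

(** Rows and columns undergo the same permutation, so its sign appears squared. This permits any
    convenient vertex order. *)
Lemma det_reindex (K : fieldType) (T : finType) (n : nat) (h : 'I_n -> T)
    (F : T -> T -> K) : bijective h ->
  \det (\matrix_(i < #|T|, j < #|T|) F (enum_val i) (enum_val j)) =
  \det (\matrix_(i < n, j < n) F (h i) (h j)).
Proof.
move=> hb; have nT : n = #|T| by rewrite -(bij_eq_card hb) card_ord.
move: h hb; rewrite nT => h hb.
have s_inj : injective (fun i => enum_rank (h i)).
  by move=> i j /enum_rank_inj/(bij_inj hb).
pose M := \matrix_(i < #|T|, j < #|T|) F (enum_val i) (enum_val j).
rewrite -/M [X in _ = \det X](_ : _ =
  row_perm (perm s_inj) (col_perm (perm s_inj) M)).
  rewrite row_permE col_permE !det_mulmx !det_perm odd_permV mulrCA -expr2.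
  by rewrite sqrr_sign mulr1.
by apply/matrixP=> i j; rewrite !mxE !permE !enum_rankK.
Qed.

Lemma phi_reindex (R : rcfType) (G : sgraph) (alpha : R) (n : nat)
    (h : 'I_n -> G) (z : ratfun R) : bijective h ->
  phi (A_alpha G alpha) z = \det (\matrix_(i < n, j < n)
    (z *+ (h i == h j) - ratconst (alpha * ((deg (h i))%:R *+ (h i == h j))
    + (1 - alpha) * (adj (h i) (h j))%:R))).
Proof.
move=> hb; rewrite -(det_reindex (fun u v => z *+ (u == v) -
  ratconst (alpha * ((deg u)%:R *+ (u == v)) + (1 - alpha) * (adj u v)%:R)) hb).
congr (\det _); apply/matrixP=> i j.
by rewrite !mxE (inj_eq enum_val_inj).
Qed.

(** Exhibits the shifted [phi] as a monic polynomial, hence nonzero; this yields invertibility of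
    the [G2] block. *)
Lemma phi_char_poly (R : rcfType) (n : nat) (A : 'M[R]_n) (c : R) :
  phi A (ratvar R - ratconst c) = tofrac (char_poly (A + c%:M)).
Proof.
rewrite /char_poly -det_map_mx; congr (\det _); apply/matrixP=> i j.
rewrite !mxE rmorphB rmorphMn /= polyCD rmorphD /= /ratvar /ratconst.
by case: (i == j); rewrite ?mulr1n ?mulr0n ?polyC0 ?rmorph0; ring.
Qed.

Lemma ratvar_subC_neq0 (R : rcfType) (c : R) : ratvar R - ratconst c != 0.
Proof. by rewrite -tofracB tofrac_eq0 polyXsubC_eq0. Qed.

Lemma ratvar_quadratic_neq0 (R : rcfType) (c d e : R) :
  (ratvar R - ratconst c) * (ratvar R - ratconst d) - ratconst e != 0.
Proof.
rewrite -!tofracB -tofracM -tofracB tofrac_eq0 subr_eq0.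
apply/eqP=> /(congr1 (fun p : {poly R} => size p)).
rewrite size_mul ?polyXsubC_eq0 // !size_XsubC size_polyC.
by case: (e == 0).
Qed.

Section JoinMatrix.
Variables (R : rcfType) (alpha : R) (G1 G2 : sgraph).
Let edge : finType := {e : {set G1} | e \in edges G1}.

(** This order, original vertices, then edges, then [G2], matches the blocks of the determinant. *)
Definition join_enum (i : 'I_(#|G1| + #|edge| + #|G2|)) :
    Qvertex_join G1 G2 :=
  match split i with
  | inl j => inl (match split j with
                  | inl x => inl (enum_val x)
                  | inr e => inr (enum_val e)
                  end)
  | inr z => inr (enum_val z)
  end.

Lemma join_enum_vertex x :
  join_enum (lshift _ (lshift _ x)) = inl (inl (enum_val x)).
Proof. by rewrite /join_enum (unsplitK (inl _)) (unsplitK (inl _)). Qed.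

Lemma join_enum_edge e :
  join_enum (lshift _ (rshift _ e)) = inl (inr (enum_val e)).
Proof. by rewrite /join_enum (unsplitK (inl _)) (unsplitK (inr _)). Qed.

Lemma join_enum_right z : join_enum (rshift _ z) = inr (enum_val z).
Proof. by rewrite /join_enum (unsplitK (inr _)). Qed.

Definition join_enumE := (join_enum_vertex, join_enum_edge, join_enum_right).

Lemma join_enum_bij : bijective join_enum.
Proof.
exists (fun v : Qvertex_join G1 G2 => match v with
  | inl (inl x) => lshift _ (lshift _ (enum_rank x))
  | inl (inr e) => lshift _ (rshift _ (enum_rank e))
  | inr z => rshift _ (enum_rank z)
  end).
  move=> i; case: (split_ordP i) => [j ->|z ->]; last first.
    by rewrite join_enumE enum_valK.
  by case: (split_ordP j) => [x ->|e ->]; rewrite join_enumE enum_valK.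
by case=> [[x|e]|z]; rewrite join_enumE enum_rankK.
Qed.

Definition incidence_mx (K : fieldType) : 'M[K]_(#|G1|, #|edge|) :=
  \matrix_(x, e) (enum_val x \in val (enum_val e : edge))%:R.

Lemma incidence_mul_tr (K : fieldType) (t : nat) (x y : 'I_#|G1|) :
  regular G1 t ->
  (incidence_mx K *m (incidence_mx K)^T) x y =
  (t * (x == y) + adj (enum_val x) (enum_val y))%:R.
Proof.
move=> Gt; transitivity (\sum_(e : edge)
   ((enum_val x \in val e) && (enum_val y \in val e))%:R : K).
  rewrite mxE [RHS](reindex (@enum_val edge edge)) /=; last first.
    exact: onW_bij (enum_val_bij _).
  by apply: eq_bigr => e _; rewrite !mxE -natrM mulnb.
rewrite -natr_sum; congr (_%:R).
rewrite (big_edges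
  (fun f : {set G1} => (enum_val x \in f) && (enum_val y \in f) : nat)).
rewrite sum_incident2 (inj_eq enum_val_inj) Gt.
by case: eqVneq => [->|_]; rewrite ?adj_irr ?muln1 ?muln0 ?addn0.
Qed.

Lemma incidence_tr_mul (K : fieldType) (e f : 'I_#|edge|) :
  ((incidence_mx K)^T *m incidence_mx K) e f =
  ((e == f).*2 + @Qadj G1 (inr (enum_val e)) (inr (enum_val f)))%:R.
Proof.
rewrite mxE.
transitivity (\sum_(x : G1)
   ((x \in val (enum_val e : edge)) && (x \in val (enum_val f : edge)))%:R : K).
  rewrite [RHS](reindex (@enum_val G1 G1)) /=; last first.
    exact: onW_bij (enum_val_bij _).
  by apply: eq_bigr => x _; rewrite !mxE -natrM mulnb.
rewrite -natr_sum; congr (_%:R).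
transitivity #|val (enum_val e : edge) :&: val (enum_val f : edge)|.
  rewrite -sum1_card [RHS]big_mkcond; apply: eq_bigr => x _.
  by rewrite inE; case: (_ && _).
by rewrite (card_edgeI (valP _) (valP _)) -(inj_eq enum_val_inj).
Qed.

Lemma phi_join t : regular G1 t ->
  let nu := ratvar R in
  let a := ratconst alpha in
  let b := 1 - a in
  let Rm := incidence_mx (ratfun R) in
  phi (A_alpha (Qvertex_join G1 G2) alpha) nu =
  \det (block_mx
    (block_mx (nu - a * t%:R - a * #|G2|%:R)%:M (- (b *: Rm)) (- (b *: Rm^T))
       ((nu + 2 - 2 * a - 2 * a * t%:R)%:M - b *: (Rm^T *m Rm)))
    (col_mx (const_mx (- b)) 0) (row_mx (const_mx (- b)) 0)
    ((nu - a * #|G1|%:R)%:M - map_mx (@ratconst R) (A_alpha G2 alpha))).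
Proof.
move=> Gt nu a b Rm; rewrite (phi_reindex _ _ join_enum_bij).
have rD : {morph @ratconst R : u v / u + v} := rmorphD _.
have rM : {morph @ratconst R : u v / u * v} := rmorphM _.
have rMn k : {morph @ratconst R : u / u *+ k} := rmorphMn _ k.
have rn k : ratconst k%:R = k%:R :> ratfun R := rmorph_nat (@ratconst R) k.
have rb : ratconst (1 - alpha) = b by rewrite rmorphB rmorph1.
have r0 : @ratconst R 0 = 0 := rmorph0 _.
congr (\det _); apply/matrixP=> i j; rewrite mxE.
have eL (u v : Qgraph G1) : (inl u == inl v :> Qvertex_join G1 G2) = (u == v).
  by [].
have eLR (u : Qgraph G1) (v : G2) :
  (inl u == inr v :> Qvertex_join G1 G2) = false by [].
have eRL (u : Qgraph G1) (v : G2) :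
  (inr v == inl u :> Qvertex_join G1 G2) = false by [].
have eR (u v : G2) : (inr u == inr v :> Qvertex_join G1 G2) = (u == v) by [].
have eLl (u v : G1) : (inl u == inl v :> Qgraph G1) = (u == v) by [].
have eLlr (u : G1) (v : edge) : (inl u == inr v :> Qgraph G1) = false by [].
have eLrl (u : G1) (v : edge) : (inr v == inl u :> Qgraph G1) = false by [].
have eLr (u v : edge) : (inr u == inr v :> Qgraph G1) = (u == v) by [].
have eE := (eL, eLR, eRL, eR, eLl, eLlr, eLrl, eLr).
case: (split_ordP i) => [i' -> {i}|x -> {i}];
  first case: (split_ordP i') => [x -> {i'}|x -> {i'}].
all: case: (split_ordP j) => [j' -> {j}|y -> {j}];
  first case: (split_ordP j') => [y -> {j'}|y -> {j'}].
all: rewrite ?block_mxEul ?block_mxEur ?block_mxEdl ?block_mxEdr.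
all: rewrite ?col_mxEu ?col_mxEd ?row_mxEl ?row_mxEr !join_enumE.
all: rewrite ?deg_join_vertex ?(deg_join_edge G2 _ Gt) ?deg_join_right ?Gt.
all: rewrite ?eE ?(inj_eq enum_val_inj) ?mulr0n ?mulr0 ?add0r ?sub0r.
(* This closes the two zero blocks between edge vertices and [G2]. *)
all: try by rewrite rmorph0 oppr0 mxE.
all: rewrite ?(rD, rM, rMn, rn, rb, r0) -/a.
- by rewrite addr0 mxE natrD; case: (x == y); rewrite ?mulr1n ?mulr0n ?mulr0 ?subr0 //; ring.
- by rewrite !mxE.
- by rewrite !mxE mulr1.
- by rewrite !mxE.
(* The diagonal of [Rm^T *m Rm] is 2; the summand [2 - 2 * a] in the scalar part compensates for
   it. *)
- have E (M : 'M[ratfun R]_#|edge|) c :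
    (c%:M - b *: M) x y = c *+ (x == y) - b * M x y by rewrite !mxE.
  rewrite E incidence_tr_mul natrD natrM -mul2n natrM /b /=.
  by case: (x == y); rewrite ?mulr1n ?mulr0n; ring.
- by rewrite !mxE mulr1.
rewrite !mxE !(rD, rM, rMn, rn, rb) -/a natrD /=.
by case: (x == y); rewrite ?mulr1n ?mulr0n; ring.
Qed.

End JoinMatrix.

(** * The spectrum of [A_alpha] for a regular graph *)

Lemma A_alpha_regularE (R : rcfType) (G : sgraph) (alpha : R) (t : nat) i j :
  regular G t ->
  A_alpha G alpha i j = alpha * (t%:R *+ (i == j))
    + (1 - alpha) * (adj (enum_val i) (enum_val j))%:R.
Proof. by move=> Gt; rewrite !mxE Gt. Qed.

Lemma A_alpha_sym (R : rcfType) (G : sgraph) (alpha : R) :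
  (A_alpha G alpha)^T = A_alpha G alpha.
Proof.
apply/matrixP=> i j; rewrite !mxE adj_sym eq_sym.
by case: eqVneq => [->|].
Qed.

(** The degree part contributes [alpha * t] and the adjacency part [(1 - alpha) * t]. *)
Lemma A_alpha_col_sum (R : rcfType) (G : sgraph) (alpha : R) (t : nat) j :
  regular G t -> \sum_i A_alpha G alpha i j = t%:R.
Proof.
move=> Gt; under eq_bigr do rewrite (A_alpha_regularE _ _ _ Gt).
rewrite big_split /= -!mulr_sumr -natr_sum.
have -> : (\sum_(i < #|G|) adj (enum_val i) (enum_val j) = deg (enum_val j))%N.
  rewrite deg_sum [RHS](reindex (@enum_val G G)) /=; last first.
    exact: onW_bij (enum_val_bij _).
  by apply: eq_bigr => i _; rewrite adj_sym.
rewrite Gt (bigD1 j) //= eqxx big1 => [|i /negPf ->]; last by rewrite mulr0n.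
by rewrite mulr1n; ring.
Qed.

(** The bounds on [alpha] make all entries nonnegative, so [t] is the eigenvalue numbered 1. *)
Lemma char_poly_A_alpha (R : rcfType) (G : sgraph) (alpha : R) (t : nat) :
  0 <= alpha <= 1 -> (0 < #|G|)%N -> regular G t ->
  char_poly (A_alpha G alpha) =
  ('X - t%:R%:P) *
  \prod_(2 <= i < #|G|.+1) ('X - (eigval (A_alpha G alpha) i)%:P).
Proof.
case/andP=> a0 a1 G0 Gt; apply: char_poly_const_col_sum => // [|i j|j].
- exact: A_alpha_sym.
- by rewrite (A_alpha_regularE _ _ _ Gt) addr_ge0 // mulr_ge0 ?subr_ge0
    ?mulrn_wge0 ?ler0n.
- exact: A_alpha_col_sum.
Qed.

(** * Assembly of the characteristic polynomial of the join *)

Unset Implicit Arguments.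

Theorem theorem3p1 (R : rcfType) (alpha : R) (G1 G2 : sgraph)
    (t1 n1 m1 n2 : nat)
    (alpha01 : 0 <= alpha <= 1)
    (G1_nonempty : (0 < n1)%N)
    (G1_regular : regular G1 t1)
    (G1_order : #|G1| = n1)
    (G1_size : #|edges G1| = m1)
    (G2_order : #|G2| = n2) :
  let nu : ratfun R := ratvar R in
  let a : ratfun R := ratconst alpha in
  let lambda (i : nat) : ratfun R := ratconst (eigval (A_alpha G1 alpha) i) in
  let t : ratfun R := t1%:R in
  let N1 : ratfun R := n1%:R in
  let N2 : ratfun R := n2%:R in
  phi (A_alpha (Qvertex_join G1 G2) alpha) nu =
    (nu + 2 - 2 * a - 2 * a * t) ^ (m1%:Z - n1%:Z)
    * phi (A_alpha G2 alpha) (nu - a * N1)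
    * (\prod_(2 <= i < n1.+1)
         (nu ^+ 2 - (t - 2 + lambda i + a * (2 + t + N2)) * nu
          - 2 * a * N2 * (1 - a)
          - (1 - a * (1 + t + N2)) * (t + lambda i)))
    * ((nu - a * t - a * N2) * (nu + 2 - 2 * a - 2 * t)
       - 2 * t * (1 - a) ^+ 2
       - N1 * (1 - a) ^+ 2 * (nu + 2 - 2 * a - 2 * t)
         * coronal (A_alpha G2 alpha) (nu - a * N1)).
Proof.
move=> nu a lambda t N1 N2.
have m1E : m1 = #|{: {e : {set G1} | e \in edges G1}}|.
  by rewrite card_sig -G1_size; apply: eq_card.
rewrite (phi_join alpha G2 G1_regular) -/nu -/a m1E /N1 /N2 -G1_order -G2_order.
pose B := map_mx (@ratconst R) (A_alpha G1 alpha).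
(* From [(1 - a)(A + t I) = A_alpha + (1 - 2 a) t I], where [A] is the adjacency matrix of [G1]. *)
pose r := (1 - 2 * a) * t.
set c := nu + 2 - 2 * a - 2 * a * t.
set x := nu - a * t - a * #|G2|%:R.
set W := _ - map_mx _ (A_alpha G2 alpha).
have tE : t = ratconst t1%:R by rewrite rmorph_nat.
have b1 : ratconst (1 - alpha) = 1 - a by rewrite rmorphB rmorph1.
have c0 : c != 0.
  rewrite (_ : c = nu - ratconst (2 * alpha + 2 * alpha * t1%:R - 2))
    ?ratvar_subC_neq0 //.
  by rewrite !(rmorphD, rmorphB, rmorphM, rmorph_nat) -/a /c /t; ring.
have q0 : 1 - a + x != 0.
  rewrite (_ : _ + x = nu - ratconst (alpha * t1%:R + alpha * #|G2|%:R + alpha - 1))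
    ?ratvar_subC_neq0 //.
  by rewrite !(rmorphD, rmorphB, rmorphM, rmorph_nat, rmorph1) -/a /x /t; ring.
(* This is the last factor of the theorem without its coronal term, a monic quadratic in [nu]. *)
have pq : c * x - r * (1 - a + x) - (1 - a + x) * t != 0.
  rewrite (_ : _ - _ = (nu - ratconst (alpha * t1%:R + alpha * #|G2|%:R)) *
     (nu - ratconst (2 * alpha + 2 * t1%:R - 2)) -
     ratconst (2 * t1%:R * (1 - alpha) ^+ 2))
     ?ratvar_quadratic_neq0 //.
  by rewrite !(rmorphD, rmorphB, rmorphM, rmorphXn, rmorph_nat, rmorph1) -/a /x /c /r /t;
    ring.
have Wu : W \in unitmx.
  rewrite unitmxE unitfE.
  have := phi_char_poly (A_alpha G2 alpha) (alpha * #|G1|%:R).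
  have -> : ratconst (alpha * #|G1|%:R) = a * #|G1|%:R by rewrite rmorphM rmorph_nat.
  move=> E; rewrite -[\det W]/(phi _ _) E.
  by rewrite tofrac_eq0 monic_neq0 // char_poly_monic.
pose Rm := incidence_mx G1 (ratfun R).
have RR : (1 - a) *: (Rm *m Rm^T) = B + r%:M.
  apply/matrixP=> i j.
  rewrite mxE (incidence_mul_tr _ _ _ G1_regular) [RHS]mxE [B i j]mxE.
  rewrite (A_alpha_regularE _ _ _ G1_regular).
  rewrite (rmorphD (@ratconst R)) !(rmorphM (@ratconst R)) (rmorphMn (@ratconst R)).
  rewrite !(rmorph_nat (@ratconst R)) /= b1 mxE natrD natrM -/a -/t /r.
  by case: (i == j); rewrite ?mulr1n ?mulr0n; ring.
have B1 : B *m (const_mx 1 : 'cV_#|G1|) = const_mx t.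
  apply/matrixP=> i j; rewrite !mxE tE -(A_alpha_col_sum alpha i G1_regular) rmorph_sum.
  apply: eq_bigr => k _; rewrite !mxE mulr1; congr (ratconst _).
  (* Symmetry turns the column sums into row sums. *)
  by move/matrixP/(_ k i): (A_alpha_sym G1 alpha); rewrite !mxE.
have Bs : char_poly B = ('X - t%:P) * \prod_(2 <= i < #|G1|.+1) ('X - (lambda i)%:P).
  rewrite -map_char_poly (char_poly_A_alpha alpha01 _ G1_regular) ?G1_order //.
  rewrite rmorphM rmorph_prod /= rmorphB /= map_polyX map_polyC /= -tE; congr (_ * _).
  by apply: eq_bigr => i _; rewrite rmorphB /= map_polyX map_polyC.
rewrite (det_incidence_join _ Wu c0 q0 pq RR B1 Bs); last by rewrite G1_order.
rewrite -[\det W]/(phi (A_alpha G2 alpha) (nu - a * #|G1|%:R)).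
rewrite -[(_ *m invmx W *m _) 0 0]/(coronal (A_alpha G2 alpha)
  (nu - a * #|G1|%:R)).
move: (coronal _ _) (phi _ _) => ups phi2.
have pE i : c * x - r * (1 - a + x) - (1 - a + x) * lambda i =
   nu ^+ 2 - (t - 2 + lambda i + a * (2 + t + #|G2|%:R)) * nu
     - 2 * a * #|G2|%:R * (1 - a) - (1 - a * (1 + t + #|G2|%:R)) * (t + lambda i).
  by rewrite /c /x /r; ring.
rewrite (eq_bigr _ (fun i _ => pE i)).
move: (\prod_(2 <= i < _) _) (c ^ _) => P C.
apply: f_equal2 => //.
(* The coefficient [c - t - r] of the coronal term equals [nu + 2 - 2 * a - 2 * t]. *)
by rewrite /c /x /r; ring.
Qed.
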